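(* For every finite group $G$, $$|\mathrm{Irr}(\mathbb C[\Lambda^2G])|=\kappa_3(G)=|G|^3P_4(G).$$ Equivalently, $$P_4(G)=\frac{|\mathrm{Irr}(\mathbb C[\Lambda^2G])|}{|G|^3}.$$
   Context: $\Lambda^2G$ is the double loop groupoid of $G$: its objects are the commuting pairs $(g,h)\in G^2$, and its morphisms are given by simultaneous conjugation (a morphism $(g,h)\to(g',h')$ is an element $x\in G$ with $xgx^{-1}=g'$ and $xhx^{-1}=h'$); so the automorphism group of $(g,h)$ is $C_G(g)\cap C_G(h)$. For a finite groupoid $\mathcal G$, $\mathbb C[\mathcal G]$ is the groupoid algebra: the $\mathbb C$-vector space with basis the morphisms of $\mathcal G$, with product given by composition when morphisms are composable and $0$ otherwise. $\mathrm{Irr}(B)$ is the set of isomorphism classes of simple $B$-modules. For $r\ge 1$, $\mathrm{Comm}_r(G):=\{(x_1,\dots,x_r)\in G^r : x_ix_j=x_jx_i\ \text{for all } i,j\}$, $P_r(G):=|\mathrm{Comm}_r(G)|/|G|^r$, and $\kappa_r(G)$ is the number of orbits of $G$ acting on $\mathrm{Comm}_r(G)$ by simultaneous conjugation. *)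

(* Defs.v *)
From HB Require Import structures.
From mathcomp Require Import all_boot all_order all_algebra all_fingroup.
From mathcomp Require Import all_solvable complex.
From mathcomp Require Import all_classical all_reals.

Set Implicit Arguments.
Unset Strict Implicit.
Unset Printing Implicit Defensive.
Import GRing.Theory.
Local Open Scope ring_scope.

Record groupoid := Groupoid {
  gob : finType;
  ghom : gob -> gob -> finType;
  gid : forall a, ghom a a;
  gcomp : forall a b c, ghom b c -> ghom a b -> ghom a c;
  ginv : forall a b, ghom a b -> ghom b a;
  gcompA : forall a b c d (f : ghom c d) (g : ghom b c) (h : ghom a b),
    gcomp f (gcomp g h) = gcomp (gcomp f g) h;
  gcomp1m : forall a b (f : ghom a b), gcomp (gid b) f = f;
  gcompm1 : forall a b (f : ghom a b), gcomp f (gid a) = f;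
  gcompVm : forall a b (f : ghom a b), gcomp (ginv f) f = gid a;
  gcompmV : forall a b (f : ghom a b), gcomp f (ginv f) = gid b
}.

Section GroupoidAlgebra.
Variables (F : comNzRingType) (X : groupoid).

Definition garrow := {ab : gob X * gob X & ghom ab.1 ab.2}.
HB.instance Definition _ := Finite.on garrow.
Definition arr (a b : gob X) (f : ghom a b) : garrow :=
  @Tagged _ (a, b) (fun ab => ghom ab.1 ab.2 : Type) f.

Definition groupoid_algebra := {ffun garrow -> F}.
HB.instance Definition _ :=
  GRing.Lmodule.copy groupoid_algebra {ffun garrow -> F^o}.

Implicit Types u v w : groupoid_algebra.

(* The bilinear extension of "f * g = gcomp f g if f and g are composable,
   and 0 otherwise"; see [gbasisM] and [gbasisM0]. *)
Definition galg_mul u v : groupoid_algebra :=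
  [ffun m : garrow => \sum_b
     \sum_(f : ghom b (tag m).2) \sum_(g : ghom (tag m).1 b
       | gcomp f g == tagged m) u (arr f) * v (arr g)].

Definition galg_one : groupoid_algebra :=
  [ffun m : garrow => ([exists a, m == arr (gid a)])%:R].

Definition gbasis (m : garrow) : groupoid_algebra :=
  [ffun n => (n == m)%:R].

Lemma galg_mulE u v a c (m : ghom a c) : galg_mul u v (arr m) =
  \sum_b \sum_(f : ghom b c) \sum_(g : ghom a b | gcomp f g == m)
    u (arr f) * v (arr g).
Proof. by rewrite ffunE. Qed.

Lemma arr_inj a b : injective (@arr a b).
Proof. by move=> f g /eqP; rewrite eq_Tagged => /eqP. Qed.

Lemma galg_ext u v : (forall a b (f : ghom a b), u (arr f) = v (arr f)) -> u = v.
Proof. by move=> uv; apply/ffunP => -[[a b] f]; apply: uv. Qed.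

Lemma galg_oneE a b (f : ghom a b) :
  galg_one (arr f) = [exists c, arr f == arr (gid c)]%:R.
Proof. by rewrite ffunE. Qed.

Lemma galg_one_id a (f : ghom a a) : galg_one (arr f) = (f == gid a)%:R.
Proof.
rewrite galg_oneE; congr (_%:R); congr nat_of_bool; apply/existsP/eqP => [[c /eqP e]|->].
  have /= ec := congr1 (fun m : garrow => (tag m).1) e.
  by move: e; rewrite -ec => /arr_inj.
by exists a.
Qed.

Lemma galg_one_neq a b (f : ghom a b) : a != b -> galg_one (arr f) = 0.
Proof.
move=> ab; rewrite galg_oneE; case: existsP => // -[c /eqP e].
have e1 := congr1 (fun m : garrow => (tag m).1) e.
have e2 := congr1 (fun m : garrow => (tag m).2) e.
by move: ab; rewrite /= in e1 e2; rewrite e1 e2 eqxx.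
Qed.

Lemma galg_mulA : associative galg_mul.
Proof.
move=> u v w; apply: galg_ext => a d m; rewrite !galg_mulE.
transitivity (\sum_c \sum_b \sum_(f : ghom c d) \sum_(g : ghom b c)
  \sum_(h : ghom a b | gcomp f (gcomp g h) == m)
    u (arr f) * v (arr g) * w (arr h)).
  apply: eq_bigr => c _; rewrite [RHS]exchange_big /=; apply: eq_bigr => f _.
  rewrite (eq_bigr (fun n : ghom a c => \sum_(b : gob X) \sum_(g : ghom b c)
     \sum_(h : ghom a b | gcomp g h == n) u (arr f) * v (arr g) * w (arr h)));
    last first.
    move=> n _; rewrite galg_mulE mulr_sumr; apply: eq_bigr => b _.
    rewrite mulr_sumr; apply: eq_bigr => g _.
    by rewrite mulr_sumr; apply: eq_bigr => h _; rewrite mulrA.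
  rewrite exchange_big; apply: eq_bigr => b _.
  rewrite exchange_big; apply: eq_bigr => g _ /=.
  rewrite [RHS](partition_big (gcomp g) (fun n => gcomp f n == m)) //=.
  apply: eq_bigr => n /eqP fn; apply: eq_bigl => h.
  by case: (gcomp g h =P n) => [->|]; rewrite ?fn ?eqxx ?andbF.
rewrite exchange_big; apply: eq_bigr => b _ /=.
transitivity (\sum_(k : ghom b d) \sum_(h : ghom a b | gcomp k h == m)
  \sum_c \sum_(f : ghom c d) \sum_(g : ghom b c | gcomp f g == k)
    u (arr f) * v (arr g) * w (arr h)); last first.
  apply: eq_bigr => k _; apply: eq_bigr => h _.
  rewrite galg_mulE mulr_suml; apply: eq_bigr => c _.
  rewrite mulr_suml; apply: eq_bigr => f _.
  by rewrite mulr_suml.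
rewrite [RHS](eq_bigr (fun k : ghom b d => \sum_(c : gob X) \sum_(f : ghom c d)
  \sum_(g : ghom b c | gcomp f g == k) \sum_(h : ghom a b | gcomp k h == m)
    u (arr f) * v (arr g) * w (arr h))); last first.
  move=> k _; rewrite exchange_big; apply: eq_bigr => c _.
  rewrite exchange_big; apply: eq_bigr => f _.
  by rewrite exchange_big.
rewrite [RHS]exchange_big; apply: eq_bigr => c _.
rewrite [RHS]exchange_big; apply: eq_bigr => f _ /=.
rewrite [LHS](partition_big (gcomp f) xpredT) //=.
apply: eq_bigr => k _; apply: eq_bigr => g /eqP <-.
by apply: eq_bigl => h; rewrite gcompA.
Qed.

Lemma galg_mul1 : left_id galg_one galg_mul.
Proof.
move=> u; apply: galg_ext => a c m; rewrite galg_mulE (bigD1 c) //=.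
rewrite [X in _ + X]big1 ?addr0; last first.
  by move=> b bc; rewrite big1 // => f _; rewrite big1 // => g _;
     rewrite galg_one_neq ?mul0r.
rewrite (bigD1 (gid c)) //= [X in _ + X]big1 ?addr0; last first.
  by move=> f /negPf fc; rewrite big1 // => g _; rewrite galg_one_id fc mul0r.
rewrite (eq_bigl (pred1 m)); last by move=> g /=; rewrite gcomp1m.
by rewrite big_pred1_eq galg_one_id eqxx mul1r.
Qed.

Lemma galg_mulr1 : right_id galg_one galg_mul.
Proof.
move=> u; apply: galg_ext => a c m; rewrite galg_mulE (bigD1 a) //=.
rewrite [X in _ + X]big1 ?addr0; last first.
  by move=> b ba; rewrite big1 // => f _; rewrite big1 // => g _;
     rewrite galg_one_neq ?mulr0 // eq_sym.
rewrite (bigD1 m) //= [X in _ + X]big1 ?addr0; last first.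
  move=> f /negPf fm; rewrite big1 // => g /eqP fg.
  rewrite galg_one_id; case: (g =P gid a) => [g1|_]; last by rewrite mulr0.
  by move: fg fm; rewrite g1 gcompm1 => ->; rewrite eqxx.
rewrite (bigD1 (gid a)) ?gcompm1 //= big1 ?addr0.
  by rewrite galg_one_id eqxx mulr1.
by move=> g /andP[_ /negPf g1]; rewrite galg_one_id g1 mulr0.
Qed.

Lemma galg_mulDl : left_distributive galg_mul +%R.
Proof.
move=> u v w; apply/ffunP => m; rewrite !ffunE -big_split; apply: eq_bigr => b _.
rewrite -big_split; apply: eq_bigr => f _; rewrite -big_split.
by apply: eq_bigr => g _; rewrite ffunE mulrDl.
Qed.

Lemma galg_mulDr : right_distributive galg_mul +%R.
Proof.
move=> u v w; apply/ffunP => m; rewrite !ffunE -big_split; apply: eq_bigr => b _.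
rewrite -big_split; apply: eq_bigr => f _; rewrite -big_split.
by apply: eq_bigr => g _; rewrite ffunE mulrDr.
Qed.

(* Only a [pzRingType]: the algebra of the empty groupoid is the zero ring. *)
HB.instance Definition _ := GRing.Zmodule_isPzRing.Build groupoid_algebra
  galg_mulA galg_mul1 galg_mulr1 galg_mulDl galg_mulDr.

Lemma galg_scalerAl (k : F) u v : k *: (u * v) = (k *: u) * v.
Proof.
apply/ffunP => m; rewrite !ffunE scaler_sumr; apply: eq_bigr => b _.
rewrite scaler_sumr; apply: eq_bigr => f _; rewrite scaler_sumr.
by apply: eq_bigr => g _; rewrite ffunE; apply: mulrA.
Qed.

Lemma galg_scalerAr (k : F) u v : k *: (u * v) = u * (k *: v).
Proof.
apply/ffunP => m; rewrite !ffunE scaler_sumr; apply: eq_bigr => b _.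
rewrite scaler_sumr; apply: eq_bigr => f _; rewrite scaler_sumr.
by apply: eq_bigr => g _; rewrite ffunE; apply: mulrCA.
Qed.

Lemma gbasis_decomp u : u = \sum_m u m *: gbasis m.
Proof.
apply/ffunP => m; rewrite sum_ffunE (bigD1 m) //= !ffunE eqxx.
rewrite [X in _ + X]big1 ?addr0; first exact/esym/mulr1.
by move=> n nm; rewrite !ffunE eq_sym (negPf nm) scaler0.
Qed.

Lemma gbasisM a b c (f : ghom b c) (g : ghom a b) :
  gbasis (arr f) * gbasis (arr g) = gbasis (arr (gcomp f g)).
Proof.
apply: galg_ext => a' c' m; rewrite [LHS]galg_mulE [RHS]ffunE.
have [e|ne] := arr m =P arr (gcomp f g); last first.
  rewrite big1 // => b' _; rewrite big1 // => f' _; rewrite big1 // => g' /eqP m'.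
  rewrite !ffunE; case: eqP => [ef|_]; last by rewrite mul0r.
  case: eqP => [eg|_]; last by rewrite mulr0.
  case: ne; rewrite -m'.
  have eb := congr1 (fun n : garrow => (tag n).1) ef.
  have ec := congr1 (fun n : garrow => (tag n).2) ef.
  have ea := congr1 (fun n : garrow => (tag n).1) eg.
  rewrite /= in ea eb ec; subst a' b' c'.
  by rewrite (arr_inj ef) (arr_inj eg).
have ea := congr1 (fun n : garrow => (tag n).1) e.
have ec := congr1 (fun n : garrow => (tag n).2) e.
rewrite /= in ea ec; subst a' c'; rewrite (arr_inj e).
rewrite (bigD1 b) //= [X in _ + X]big1 ?addr0; last first.
  move=> b' nb; rewrite big1 // => f' _; rewrite big1 // => g' _.
  rewrite !ffunE; case: eqP => [ef|_]; last by rewrite mul0r.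
  have eb := congr1 (fun n : garrow => (tag n).1) ef.
  by rewrite /= in eb; rewrite eb eqxx in nb.
rewrite (bigD1 f) //= [X in _ + X]big1 ?addr0; last first.
  move=> f' /negPf nf; rewrite big1 // => g' _; rewrite !ffunE.
  by rewrite (inj_eq (@arr_inj _ _)) nf mul0r.
rewrite (bigD1 g) //= [X in _ + X]big1 ?addr0; last first.
  move=> g' /andP[_ /negPf ng]; rewrite !ffunE.
  by rewrite !(inj_eq (@arr_inj _ _)) ng mulr0.
by rewrite !ffunE !eqxx mulr1.
Qed.

Lemma gbasisM0 a b b' c (f : ghom b c) (g : ghom a b') :
  b != b' -> gbasis (arr f) * gbasis (arr g) = 0.
Proof.
move=> nb; apply: galg_ext => x z m; rewrite [LHS]galg_mulE [RHS]ffunE.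
rewrite big1 // => y _; rewrite big1 // => f' _; rewrite big1 // => g' _.
rewrite !ffunE; case: eqP => [ef|_]; last by rewrite mul0r.
case: eqP => [eg|_]; last by rewrite mulr0.
have e1 := congr1 (fun n : garrow => (tag n).1) ef.
have e2 := congr1 (fun n : garrow => (tag n).2) eg.
by rewrite /= in e1 e2; rewrite -e1 -e2 eqxx in nb.
Qed.

End GroupoidAlgebra.

Section SimpleModules.
Variable B : pzRingType.

Definition simple_module (V : lmodType B) : Prop :=
  (exists v : V, v != 0) /\
  forall S : {pred V}, submod_closed S -> S =i pred1 0 \/ S =i predT.

Definition isomorphic_modules (V W : lmodType B) : Prop :=
  exists f : {linear V -> W}, bijective f.

(* Isomorphism classes are predicates on [lmodType B] rather than elements of
   [set (lmodType B)]: the latter is ill-formed, as the universe of [lmodType B]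
   is too large for [set]. *)
Definition is_simple_iso_class (C : lmodType B -> Prop) : Prop :=
  exists2 V : lmodType B, simple_module V & C = isomorphic_modules V.

Definition Irr := {C : lmodType B -> Prop | is_simple_iso_class C}.

End SimpleModules.

Definition has_card (T : Type) (n : nat) : Prop :=
  exists f : 'I_n -> T, bijective f.

Section DoubleLoopGroupoid.
Variables (gT : finGroupType) (G : {group gT}).
Local Open Scope group_scope.

Definition loop2_ob : finType :=
  {gh : gT * gT | [&& gh.1 \in G, gh.2 \in G & gh.1 * gh.2 == gh.2 * gh.1]}.

Definition loop2_pred (a b : loop2_ob) (x : gT) : bool :=
  [&& x \in G, x * (val a).1 * x^-1 == (val b).1
    & x * (val a).2 * x^-1 == (val b).2].

Definition loop2_hom (a b : loop2_ob) : finType := {x : gT | loop2_pred a b x}.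

Lemma loop2_id_subproof a : loop2_pred a a 1.
Proof. by rewrite /loop2_pred group1 invg1 !mul1g !mulg1 !eqxx. Qed.

Lemma loop2_comp_subproof a b c (y : loop2_hom b c) (x : loop2_hom a b) :
  loop2_pred a c (val y * val x).
Proof.
case: y x => y /= /and3P[yG /eqP y1 /eqP y2] [x /= /and3P[xG /eqP x1 /eqP x2]].
by rewrite /loop2_pred groupM //= -y1 -y2 -x1 -x2 invMg !mulgA !eqxx.
Qed.

Lemma loop2_inv_subproof a b (x : loop2_hom a b) : loop2_pred b a (val x)^-1.
Proof.
case: x => x /= /and3P[xG /eqP x1 /eqP x2].
by rewrite /loop2_pred groupV xG -x1 -x2 invgK !mulgA mulVg !mul1g !mulgKV !eqxx.
Qed.

Definition loop2_id a : loop2_hom a a := Sub 1 (loop2_id_subproof a).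
Definition loop2_comp a b c (y : loop2_hom b c) (x : loop2_hom a b) :
  loop2_hom a c := Sub (val y * val x) (loop2_comp_subproof y x).
Definition loop2_inv a b (x : loop2_hom a b) : loop2_hom b a :=
  Sub (val x)^-1 (loop2_inv_subproof x).

Lemma loop2_compA a b c d
    (z : loop2_hom c d) (y : loop2_hom b c) (x : loop2_hom a b) :
  loop2_comp z (loop2_comp y x) = loop2_comp (loop2_comp z y) x.
Proof. by apply: val_inj; rewrite /= mulgA. Qed.

Lemma loop2_comp1m a b (x : loop2_hom a b) : loop2_comp (loop2_id b) x = x.
Proof. by apply: val_inj; rewrite /= mul1g. Qed.

Lemma loop2_compm1 a b (x : loop2_hom a b) : loop2_comp x (loop2_id a) = x.
Proof. by apply: val_inj; rewrite /= mulg1. Qed.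

Lemma loop2_compVm a b (x : loop2_hom a b) :
  loop2_comp (loop2_inv x) x = loop2_id a.
Proof. by apply: val_inj; rewrite /= mulVg. Qed.

Lemma loop2_compmV a b (x : loop2_hom a b) :
  loop2_comp x (loop2_inv x) = loop2_id b.
Proof. by apply: val_inj; rewrite /= mulgV. Qed.

Definition double_loop_groupoid : groupoid :=
  Groupoid loop2_compA loop2_comp1m loop2_compm1 loop2_compVm loop2_compmV.

Definition Comm (r : nat) : {set r.-tuple gT} :=
  [set t : r.-tuple gT | [forall i, tnth t i \in G] &&
    [forall i, forall j, tnth t i * tnth t j == tnth t j * tnth t i]].

(* ['J * r] is the right action of conjugation [y ^ x = x^-1 * y * x] on
   r-tuples; it has the same orbits as [y |-> x * y * x^-1]. *)
Definition kappa (r : nat) : nat := #|orbit ('J * r)%act G @: Comm r|.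

Definition Pcomm (r : nat) : rat := (#|Comm r|%:R / #|G|%:R ^+ r)%R.

End DoubleLoopGroupoid.

(* Main.v *)
Require Import Defs.
From HB Require Import structures.
From mathcomp Require Import all_boot all_order all_algebra all_fingroup.
From mathcomp Require Import all_solvable all_character complex.
From mathcomp Require Import all_classical all_reals.
Set Implicit Arguments.
Unset Strict Implicit.
Unset Printing Implicit Defensive.
Import GRing.Theory.
Local Open Scope ring_scope.

(** The groupoid algebra of a finite groupoid is a product of matrix algebras
    over the group algebras of its vertex groups, one factor for each connected
    component. Its simple modules therefore correspond to pairs made of a
    component and an irreducible representation of the vertex group at a base
    point, and over a closed field of good characteristic their number is the
    sum, over the components, of the numbers of conjugacy classes of the vertex
    groups ([card_Irr_groupoid_algebra]).

    The correspondence is made explicit by induction. A representation of the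
    vertex group at [x] spreads over the component of [x], once an arrow from
    [x] to each object is fixed, to a module [induced rG]. It is simple when the
    representation is irreducible ([induced_simple]), because every nonzero
    vector generates it. Its component and its representation are determined by
    its isomorphism class ([isomorphic_induced_linked],
    [induced_intertwiner]). Conversely, a nonzero vector of a simple module can
    be moved to a base point, where it receives a nonzero equivariant map from
    the regular representation of the vertex group. By Maschke's theorem this
    map is nonzero on a simple submodule; it extends to the induced module, and
    the extension is an isomorphism by Schur's lemma ([simple_is_induced]).

    For the double loop groupoid both counts reduce to that of the commuting
    quadruples, without matching components with orbits. By orbit counting, the
    number of orbits on commuting triples times the order of [G] is the number
    of commuting quadruples ([card_kappa]). On the other side, the
    vertex group at a commuting pair is its centraliser, and its number of
    classes times its order is the number of commuting pairs in it. Summing over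
    all objects gives the commuting quadruples once more ([sum_classes_Comm]).
    As an object has as many outgoing arrows as [G] has elements, that sum is
    the order of [G] times the sum over components ([sum_based_classes]). *)

(** * Vertex groups and connected components of a groupoid *)

Section VertexGroups.
Variable X : groupoid.
Implicit Types a b c d : gob X.

Lemma gcompVK a b c (f : ghom a b) (g : ghom c a) :
  gcomp (ginv f) (gcomp f g) = g.
Proof. by rewrite gcompA gcompVm gcomp1m. Qed.

Lemma gcompKV a b c (f : ghom a b) (g : ghom c b) :
  gcomp f (gcomp (ginv f) g) = g.
Proof. by rewrite gcompA gcompmV gcomp1m. Qed.

Lemma gcompmKV a b c (f : ghom b a) (g : ghom b c) :
  gcomp (gcomp g (ginv f)) f = g.
Proof. by rewrite -gcompA gcompVm gcompm1. Qed.

(** The alias makes the group structure inferable: [ghom a b] itself carries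
    none. *)
Definition vertex_group a : Type := ghom a a.
HB.instance Definition _ a := Finite.on (vertex_group a).

Section OneVertex.
Variable a : gob X.
Definition vertex_mul (f g : vertex_group a) : vertex_group a := gcomp f g.
Definition vertex_one : vertex_group a := gid a.
Definition vertex_inv (f : vertex_group a) : vertex_group a := ginv f.
Lemma vertex_mulA : associative vertex_mul.
Proof. by move=> f g h; apply: gcompA. Qed.
Lemma vertex_mul1 : left_id vertex_one vertex_mul.
Proof. by move=> f; apply: gcomp1m. Qed.
Lemma vertex_mulV : left_inverse vertex_one vertex_inv vertex_mul.
Proof. by move=> f; apply: gcompVm. Qed.
HB.instance Definition _ := Finite_isGroup.Build (vertex_group a)
  vertex_mulA vertex_mul1 vertex_mulV.
End OneVertex.

Lemma vertex_mulE a (f g : vertex_group a) : (f * g)%g = gcomp f g.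
Proof. by []. Qed.

Definition linked a b : bool := (0 < #|ghom a b|)%N.

Lemma linkedP a b : reflect (exists f : ghom a b, true) (linked a b).
Proof.
by apply: (iffP card_gt0P) => -[f _]; exists f.
Qed.

Lemma linkedI a b (f : ghom a b) : linked a b.
Proof. by apply/linkedP; exists f. Qed.

Lemma linked_refl : reflexive linked.
Proof. by move=> a; apply: linkedI (gid a). Qed.

Lemma linked_sym : symmetric linked.
Proof.
by move=> a b; apply/linkedP/linkedP => -[f _]; exists (ginv f).
Qed.

Lemma linked_trans : transitive linked.
Proof.
by move=> b a c /linkedP[f _] /linkedP[g _]; apply: linkedI (gcomp g f).
Qed.

(** The choice depends only on the set of objects linked to [a], so that
    linked objects share their base point: the fixed points of [base_point]
    are representatives of the connected components. *)
Definition base_point a : gob X := odflt a [pick b | linked a b].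

Lemma base_pointP a : linked a (base_point a).
Proof. by rewrite /base_point; case: pickP => //= _; apply: linked_refl. Qed.

Lemma base_point_linked a b : linked a b -> base_point a = base_point b.
Proof.
move=> ab; rewrite /base_point.
have -> : [pick c | linked a c] = [pick c | linked b c].
  apply: eq_pick => c; apply/idP/idP; apply: linked_trans; last by [].
  by rewrite linked_sym.
by case: pickP => //= /(_ b); rewrite linked_refl.
Qed.

Lemma base_point_id a : base_point (base_point a) = base_point a.
Proof. by apply/esym/base_point_linked/base_pointP. Qed.

(** Composition with one arrow from [a] to [b] identifies all of them with the
    vertex group at [a]. *)
Lemma card_hom_linked a b : linked a b -> #|ghom a b| = #|ghom a a|.
Proof.
case/linkedP=> t _; apply: (@bij_eq_card _ _ (fun f => gcomp (ginv t) f)).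
by exists (gcomp t) => f; rewrite (gcompVK, gcompKV).
Qed.

End VertexGroups.

(** * Modules over the groupoid algebra *)

Section ArrowAction.
Variables (F : comNzRingType) (X : groupoid).
Notation B := (groupoid_algebra F X).
Notation "''E' f" := (gbasis F (arr f) : B) (at level 8, f at level 2).

(** The identity arrows are idempotents that split every module into components
    indexed by the objects, as a bundle over the set of objects. *)
Lemma galg_one_sum : (1 : B) = \sum_(a : gob X) 'E (gid a).
Proof.
apply: galg_ext => a b f; rewrite [LHS]ffunE sum_ffunE.
case: existsP => [[c /eqP fc]|nf].
  rewrite fc (bigD1 c) //= [X in _ + X]big1 ?addr0 ?ffunE ?eqxx // => d dc.
  rewrite ffunE; case: eqP => // e; move: dc.
  have /= ec := congr1 (fun m : garrow X => (tag m).1) e.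
  by rewrite ec eqxx.
by rewrite big1 // => c _; rewrite ffunE; case: eqP => // e; case: nf;
   exists c; rewrite e.
Qed.

Variable V : lmodType B.
Implicit Types v w : V.

Lemma arrow_comp a b c (f : ghom b c) (g : ghom a b) v :
  'E f *: ('E g *: v) = 'E (gcomp f g) *: v.
Proof. by rewrite scalerA gbasisM. Qed.

Lemma arrow_noncomp a b b' c (f : ghom b c) (g : ghom a b') v :
  b != b' -> 'E f *: ('E g *: v) = 0.
Proof. by move=> nb; rewrite scalerA gbasisM0 // scale0r. Qed.

(** A module over the algebra is a vector space through the scalar multiples of
    the unit; this is the only access to scalars, as the structure of [V] is
    that of a module over a ring. *)
Definition fscale (k : F) v : V := (k *: (1 : B)) *: v.

Lemma fscaleE k (u : B) v : (k *: u) *: v = fscale k (u *: v).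
Proof. by rewrite /fscale scalerA -galg_scalerAl mul1r. Qed.

Lemma fscaleC k (u : B) v : u *: fscale k v = fscale k (u *: v).
Proof. by rewrite -fscaleE /fscale scalerA -galg_scalerAr mulr1. Qed.

Lemma fscale1 v : fscale 1 v = v.
Proof. by rewrite /fscale !scale1r. Qed.

Lemma fscaleA k l v : fscale k (fscale l v) = fscale (k * l) v.
Proof. by rewrite -fscaleE scalerA. Qed.

Lemma fscaleDl v : {morph fscale^~ v : k l / k + l}.
Proof. by move=> k l; rewrite /fscale scalerDl scalerDl. Qed.

Lemma fscale0l v : fscale 0 v = 0. Proof. by rewrite /fscale !scale0r. Qed.

Lemma fscale_sumr k I (r : seq I) P (E : I -> V) :
  fscale k (\sum_(i <- r | P i) E i) = \sum_(i <- r | P i) fscale k (E i).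
Proof. exact: scaler_sumr. Qed.

Lemma arrow_id_sum v : v = \sum_(a : gob X) 'E (gid a) *: v.
Proof. by rewrite -[LHS]scale1r galg_one_sum scaler_suml. Qed.

Lemma galg_scale_sum (u : B) v :
  u *: v = \sum_m fscale (u m) (gbasis F m *: v).
Proof.
rewrite {1}[u]gbasis_decomp scaler_suml.
by apply: eq_bigr => m _; rewrite fscaleE.
Qed.

End ArrowAction.

Section LinearityOnArrows.
Variables (F : comNzRingType) (X : groupoid).
Notation B := (groupoid_algebra F X).
Variables V W : lmodType B.

(** The arrows form a basis, so that linearity over the algebra need only be
    tested on scalars and on arrows. *)
Lemma arrow_linear (phi : V -> W) :
    {morph phi : v w / v + w} ->
    (forall k v, phi (fscale k v) = fscale k (phi v)) ->
    (forall (m : garrow X) v, phi (gbasis F m *: v) = gbasis F m *: phi v) ->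
  linear phi.
Proof.
move=> phiD phiZ phiE u v w.
have phi0 : phi 0 = 0 by rewrite -[0 in LHS](fscale0l 0) phiZ fscale0l.
rewrite phiD; congr (_ + _).
rewrite !galg_scale_sum (big_morph phi phiD phi0).
by apply: eq_bigr => m _; rewrite phiZ phiE.
Qed.

End LinearityOnArrows.

(** * The module induced from a representation of a vertex group *)

Section InducedModule.
Variables (F : comUnitRingType) (X : groupoid) (x : gob X).
Notation B := (groupoid_algebra F X).
Notation "''E' f" := (gbasis F (arr f) : B) (at level 8, f at level 2).

Definition star : finType := {b : gob X | b \in linked x}.

(** A fixed choice of arrows from [x] to the objects of its component; through
    these spokes the component becomes the product of the vertex group with the
    groupoid that has one arrow between any two objects. *)
Definition spoke (b : star) : ghom x (val b) :=
  xchoose (elimT (linkedP x (val b)) (valP b)).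

Definition transport (a b : star) (f : ghom (val a) (val b)) : vertex_group x :=
  gcomp (ginv (spoke b)) (gcomp f (spoke a)).

Definition untransport (a b : star) (g : vertex_group x) :
    ghom (val a) (val b) :=
  gcomp (spoke b) (gcomp g (ginv (spoke a))).

Lemma untransportK a b : cancel (@untransport a b) (@transport a b).
Proof. by move=> g; rewrite /transport -gcompA gcompVK gcompmKV. Qed.

Lemma transport1 a : transport (gid (val a)) = 1%g.
Proof. by rewrite /transport gcomp1m gcompVm. Qed.

Lemma transportM a b c (f : ghom (val b) (val c)) (g : ghom (val a) (val b)) :
  transport (gcomp f g) = (transport f * transport g)%g.
Proof. by rewrite vertex_mulE /transport -!gcompA gcompKV. Qed.

(** The module induced from [rG] to the algebra: one copy of the representation
    space at each object of the component of [x]. The type mentions the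
    representation although the underlying vectors do not depend on it,
    because the action of the algebra does. *)
Definition induced d of mx_representation F [set: vertex_group x] d : Type :=
  {ffun star -> 'rV[F]_d}.

Section Action.
Variables (d : nat) (rG : mx_representation F [set: vertex_group x] d).

HB.instance Definition _ :=
  GRing.Zmodule.copy (induced rG) {ffun star -> 'rV[F]_d}.
Implicit Types w : induced rG.

(** An arrow moves the copy at its source to the copy at its target, acting by
    its transport to the vertex group. Representations act on row vectors from
    the right, hence the inverse, which gives a left module. *)
Definition induced_scale (u : B) w : induced rG :=
  [ffun c => \sum_(a : star) \sum_(f : ghom (val a) (val c))
     u (arr f) *: (w a *m rG (transport f)^-1%g)].

Lemma induced_scaleA u v w :
  induced_scale u (induced_scale v w) = induced_scale (u * v) w.
Proof.
apply/ffunP => c; rewrite !ffunE.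
transitivity (\sum_(b : star) \sum_(a : star)
    \sum_(f : ghom (val b) (val c)) \sum_(g : ghom (val a) (val b))
   (u (arr f) * v (arr g)) *: (w a *m rG (transport (gcomp f g))^-1%g)).
  apply: eq_bigr => b _; rewrite exchange_big; apply: eq_bigr => f _.
  rewrite ffunE mulmx_suml scaler_sumr; apply: eq_bigr => a _.
  rewrite mulmx_suml scaler_sumr; apply: eq_bigr => g _.
  rewrite -scalemxAl scalerA -mulmxA -repr_mxM ?inE //.
  by rewrite transportM invMg.
rewrite exchange_big; apply: eq_bigr => a _ /=.
have E (h : ghom (val a) (val c)) : (u * v) (arr h) =
    \sum_(b : star) \sum_(f : ghom (val b) (val c))
      \sum_(g : ghom (val a) (val b) | gcomp f g == h) u (arr f) * v (arr g).
  (* intermediate objects outside the component of x admit no arrow from a *)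
  rewrite [LHS]galg_mulE (bigID (mem (linked x))) /= addrC big1 ?add0r.
    by rewrite big_sub.
  move=> b /negP nb; rewrite big1 // => f _; rewrite big1 // => g _.
  by case: nb; apply: linked_trans (valP a) (linkedI g).
rewrite [RHS](eq_bigr (fun h : ghom (val a) (val c) => \sum_(b : star)
  \sum_(f : ghom (val b) (val c))
    \sum_(g : ghom (val a) (val b) | gcomp f g == h)
   (u (arr f) * v (arr g)) *: (w a *m rG (transport (gcomp f g))^-1%g))).
  rewrite [RHS]exchange_big; apply: eq_bigr => b _ /=.
  rewrite [RHS]exchange_big; apply: eq_bigr => f _ /=.
  by rewrite [LHS](partition_big (gcomp f) xpredT).
move=> h _; rewrite E scaler_suml; apply: eq_bigr => b _.
rewrite scaler_suml; apply: eq_bigr => f _.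
by rewrite scaler_suml; apply: eq_bigr => g /eqP ->.
Qed.

Lemma induced_arrow (a b : star) (f : ghom (val a) (val b)) w :
  induced_scale ('E f) w =
  [ffun c => if c == b then w a *m rG (transport f)^-1%g else 0].
Proof.
apply/ffunP => c; rewrite !ffunE; case: eqP => [->|/eqP ncb]; last first.
  rewrite big1 // => a' _; rewrite big1 // => f' _; rewrite ffunE.
  case: eqP => [e|_]; last by rewrite scale0r.
  have /= /val_inj ec := congr1 (fun m : garrow X => (tag m).2) e.
  by rewrite ec eqxx in ncb.
rewrite (bigD1 a) //= [X in _ + X]big1 ?addr0; last first.
  move=> a' na; rewrite big1 // => f' _; rewrite ffunE.
  case: eqP => [e|_]; last by rewrite scale0r.
  have /= /val_inj ea := congr1 (fun m : garrow X => (tag m).1) e.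
  by rewrite ea eqxx in na.
rewrite (bigD1 f) //= [X in _ + X]big1 ?addr0.
  by rewrite ffunE eqxx scale1r.
move=> f' /negPf nf; rewrite ffunE.
by rewrite (inj_eq (@arr_inj _ _ _)) nf scale0r.
Qed.

Lemma induced_arrow0 a b (f : ghom a b) w :
  ~~ linked x a -> induced_scale ('E f) w = 0.
Proof.
move=> nxa; apply/ffunP => c; rewrite !ffunE.
rewrite big1 // => a' _; rewrite big1 // => f' _; rewrite ffunE.
case: eqP => [e|_]; last by rewrite scale0r.
have /= ea := congr1 (fun m : garrow X => (tag m).1) e.
by case/negP: nxa; rewrite -ea; apply: (valP a').
Qed.

Lemma induced_scaleDr : right_distributive induced_scale +%R.
Proof.
move=> u v w; apply/ffunP => c; rewrite !ffunE -big_split.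
apply: eq_bigr => a _; rewrite -big_split; apply: eq_bigr => f _ /=.
by rewrite ffunE mulmxDl scalerDr.
Qed.

Lemma induced_scaleDl w : {morph induced_scale^~ w : u v / u + v}.
Proof.
move=> u v; apply/ffunP => c; rewrite !ffunE -big_split.
apply: eq_bigr => a _; rewrite -big_split; apply: eq_bigr => f _ /=.
by rewrite ffunE scalerDl.
Qed.

Lemma induced_scale1 : left_id 1 induced_scale.
Proof.
move=> w; rewrite galg_one_sum.
have s0 : induced_scale 0 w = 0.
  by apply: (addrI (induced_scale 0 w)); rewrite -induced_scaleDl !addr0.
rewrite (big_morph (induced_scale^~ w) (induced_scaleDl w) s0).
rewrite (bigID (mem (linked x))) /= addrC big1 ?add0r; last first.
  by move=> b nb; apply: induced_arrow0.
rewrite big_sub; apply/ffunP => c; rewrite sum_ffunE (bigD1 c) //=.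
rewrite [X in _ + X]big1 ?addr0.
  by rewrite induced_arrow ffunE eqxx transport1 invg1 repr_mx1 mulmx1.
by move=> b nb; rewrite induced_arrow ffunE eq_sym (negPf nb).
Qed.

HB.instance Definition _ := GRing.Zmodule_isLmodule.Build B (induced rG)
  induced_scaleA induced_scale1 induced_scaleDr induced_scaleDl.

Definition at_ob (b : star) (w : 'rV[F]_d) : induced rG :=
  [ffun c => if c == b then w else 0].

End Action.
End InducedModule.

(** * Isomorphisms and Schur's lemma for modules over a ring *)

Section SimpleModules.
Variable B : pzRingType.
Implicit Types V W : lmodType B.

Lemma isomorphic_refl V : isomorphic_modules V V.
Proof. by exists idfun; exists id. Qed.

Lemma isomorphic_trans V W (U : lmodType B) :
  isomorphic_modules V W -> isomorphic_modules W U -> isomorphic_modules V U.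
Proof.
by move=> [f fbij] [g gbij]; exists (g \o f); apply: bij_comp.
Qed.

Lemma linear_isomorphic V W (phi : V -> W) :
  linear phi -> bijective phi -> isomorphic_modules V W.
Proof.
move=> phi_lin phi_bij.
pose p := GRing.isLinear.Build B V W _ phi phi_lin.
pose phiL : {linear V -> W} := HB.pack phi p.
by exists phiL.
Qed.

Lemma isomorphic_sym V W : isomorphic_modules V W -> isomorphic_modules W V.
Proof.
move=> [f [g fK gK]]; apply: (@linear_isomorphic _ _ g); last by exists f.
by move=> u v w; apply: (can_inj fK); rewrite gK linearP !gK.
Qed.

Lemma isomorphic_class V W :
  isomorphic_modules V W -> isomorphic_modules V = isomorphic_modules W.
Proof.
move=> VW; apply/funext => U; apply/propext; split.
  exact/isomorphic_trans/isomorphic_sym.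
exact: isomorphic_trans.
Qed.

(** Schur's lemma: the kernel and the image are submodules, and the value at
    [v] excludes that the kernel is everything or the image is zero. *)
Lemma simple_hom_bij V W (phi : {linear V -> W}) v :
  simple_module V -> simple_module W -> phi v != 0 -> bijective phi.
Proof.
move=> [_ Vs] [_ Ws] phiv.
have inj : injective phi.
  have kerC : submod_closed [pred u | phi u == 0].
    split; first by rewrite inE linear0.
    move=> a u w; rewrite !inE linearP => /eqP-> /eqP->.
    by rewrite scaler0 addr0.
  apply: raddf_inj => u u0.
  case: (Vs _ kerC) => K; last by have := K v; rewrite !inE (negPf phiv).
  by apply/eqP; have := K u; rewrite !inE u0 eqxx => <-.
have surj w : exists u, phi u = w.
  have imC : submod_closed [pred w | `[< exists u, phi u = w >]].
    split; first by apply/asboolP; exists 0; rewrite linear0.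
    move=> a _ _ /asboolP[u1 <-] /asboolP[u2 <-].
    by apply/asboolP; exists (a *: u1 + u2); rewrite linearP.
  case: (Ws _ imC) => I; last by apply/asboolP; rewrite (I w : asbool _ = _).
  have := I (phi v); rewrite !inE (negPf phiv) => /asboolP[].
  by exists v.
exists (fun w => projT1 (cid (surj w))) => u; last by case: cid.
by apply: inj; case: cid.
Qed.

End SimpleModules.

(** * Induced modules: simplicity, and morphisms out of them and between them *)

Section InducedTheory.
Variables (F : fieldType) (X : groupoid).
Notation B := (groupoid_algebra F X).
Notation "''E' f" := (gbasis F (arr f) : B) (at level 8, f at level 2).

Section OneRepresentation.
Variables (x : gob X) (d : nat).
Variable rG : mx_representation F [set: vertex_group x] d.
Implicit Types (w : induced rG) (a b c : star x).

Lemma induced_arrowE a b (f : ghom (val a) (val b)) w :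
  'E f *: w = at_ob rG b (w a *m rG (transport f)^-1%g).
Proof. exact: induced_arrow. Qed.

Lemma induced_fscaleE k w : fscale k w = [ffun a => k *: w a] :> induced rG.
Proof.
rewrite -[w in RHS]scale1r; apply/ffunP => c; rewrite !ffunE scaler_sumr.
apply: eq_bigr => a _; rewrite scaler_sumr; apply: eq_bigr => f _.
by rewrite ffunE scalerA.
Qed.

Lemma at_ob_fscale k a v : fscale k (at_ob rG a v) = at_ob rG a (k *: v).
Proof.
apply/ffunP => c; rewrite induced_fscaleE !ffunE.
by case: eqP => // _; rewrite scaler0.
Qed.

Lemma at_obD a : {morph at_ob rG a : u v / u + v}.
Proof.
move=> u v; apply/ffunP => c; rewrite !ffunE.
by case: eqP => // _; rewrite addr0.
Qed.

Lemma at_ob0 a : at_ob rG a 0 = 0.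
Proof. by apply/ffunP => c; rewrite !ffunE if_same. Qed.

Lemma at_ob_sum a I (r : seq I) P (E : I -> 'rV[F]_d) :
  at_ob rG a (\sum_(i <- r | P i) E i) = \sum_(i <- r | P i) at_ob rG a (E i).
Proof. exact: (big_morph _ (at_obD a) (at_ob0 a)). Qed.

Lemma at_ob_id a v : at_ob rG a v a = v.
Proof. by rewrite ffunE eqxx. Qed.

Lemma induced_decomp w : w = \sum_a at_ob rG a (w a).
Proof.
apply/ffunP => c; rewrite sum_ffunE (bigD1 c) //= at_ob_id.
rewrite big1 ?addr0 // => a nac.
by rewrite ffunE eq_sym (negPf nac).
Qed.

(** Some component of [w] is nonzero, say at [a]. Irreducibility makes its
    translates under the vertex group span the representation space, and a
    combination of arrows from [a] to [b] produces any vector at [b]. *)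
Lemma induced_cyclic w v : mx_irreducible rG -> w != 0 ->
  exists u : B, u *: w = v.
Proof.
move=> irr w0.
have [a wa0] : exists a, w a != 0.
  apply/existsP; apply: contraNT w0; rewrite negb_exists => /forallP w0.
  apply/eqP/ffunP => a; rewrite ffunE; apply/eqP.
  by have := w0 a; rewrite negbK.
have gen b : exists u : B, u *: w = at_ob rG b (v b).
  have [_ _ full] := irr.
  have vb : (v b <= cyclic_mx rG (w a))%MS.
    apply: submx_trans (submx1 _) (full _ _ (submx1 _) _).
      exact: cyclic_mx_module.
    by apply: contraNneq wa0 => c0; rewrite -submx0 -c0 cyclic_mx_id.
  have [A /envelop_mxP[k ->] ->] := cyclic_mxP vb.
  (* the inverse undoes the one in the action of arrows on row vectors *)
  exists (\sum_g k g *: 'E (untransport a b (g^-1)%g)).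
  rewrite scaler_suml mulmx_sumr at_ob_sum; apply: eq_big => [g|g _].
    by rewrite inE.
  by rewrite fscaleE induced_arrowE untransportK invgK at_ob_fscale -scalemxAr.
exists (\sum_b projT1 (cid (gen b))).
by rewrite scaler_suml [RHS]induced_decomp; apply: eq_bigr => b _; case: cid.
Qed.

Lemma induced_simple : mx_irreducible rG -> simple_module (induced rG).
Proof.
move=> irr; split.
  have [_ nz _] := irr.
  have [j [j' _]] : exists i j : 'I_d, (1%:M : 'M[F]_d) i j != 0.
    by case/matrix0Pn: nz => i [j e]; exists i; exists j.
  pose x0 : star x := Sub x (linked_refl x).
  exists (at_ob rG x0 (delta_mx 0 j)); apply/eqP => /ffunP/(_ x0).
  rewrite at_ob_id ffunE => /matrixP/(_ 0 j)/eqP.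
  by rewrite !mxE !eqxx oner_eq0.
move=> S [S0 SP]; case: (pselect (exists2 w, w \in S & w != 0)).
  move=> [w wS w0]; right => v; rewrite !inE.
  have [u <-] := induced_cyclic v irr w0.
  by rewrite -[u *: w]addr0 SP.
move=> nS; left => w; rewrite inE; apply/idP/eqP => [wS|->//].
by apply/eqP; apply: contrapT => /negP w0; apply: nS; exists w.
Qed.

(** Frobenius reciprocity, in the direction needed here: an equivariant map
    [phi] from a representation of the vertex group at [x] to [V] extends along
    the spokes to a morphism of modules on the induced module. *)
Section HomFromInduced.
Variables (V : lmodType B) (phi : 'rV[F]_d -> V).
Hypothesis phiD : {morph phi : v w / v + w}.
Hypothesis phiZ : forall k v, phi (k *: v) = fscale k (phi v).
Hypothesis phiM : forall (g : vertex_group x) v,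
  phi (v *m rG g) = 'E ((g^-1)%g : ghom x x) *: phi v.

Definition induced_hom w : V := \sum_a 'E (spoke a) *: phi (w a).

Lemma hom_vertex0 : phi 0 = 0.
Proof. by rewrite -[0 in LHS](scale0r 0) phiZ fscale0l. Qed.

Lemma induced_hom_at_ob a v :
  induced_hom (at_ob rG a v) = 'E (spoke a) *: phi v.
Proof.
rewrite /induced_hom (bigD1 a) //= at_ob_id big1 ?addr0 // => b nb.
by rewrite ffunE (negPf nb) hom_vertex0 scaler0.
Qed.

(** Equivariance under the identity forces the values of [phi] into the
    component of [V] at [x]. *)
Lemma hom_vertex_id v : 'E (gid x) *: phi v = phi v.
Proof. by rewrite -{2}[v]mulmx1 -(repr_mx1 rG) phiM invg1. Qed.

Lemma induced_hom_linear : linear induced_hom.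
Proof.
apply: arrow_linear.
- move=> u v; rewrite /induced_hom -big_split; apply: eq_bigr => a _.
  by rewrite ffunE phiD scalerDr.
- move=> k v; rewrite /induced_hom fscale_sumr; apply: eq_bigr => a _.
  by rewrite induced_fscaleE ffunE phiZ fscaleC.
move=> [[a b] /= f] w; rewrite -[existT _ _ _]/(arr f).
have [xa|nxa] := boolP (linked x a); last first.
  rewrite [_ *: w]induced_arrow0 // [in LHS]/induced_hom big1 ?scaler_sumr.
    rewrite big1 // => c _; apply: arrow_noncomp.
    by apply: contraNneq nxa => ->; apply: (valP c).
  by move=> c _; rewrite ffunE hom_vertex0 scaler0.
have xb : linked x b := linked_trans xa (linkedI f).
pose a' : star x := Sub a xa; pose b' : star x := Sub b xb.
rewrite [_ *: w](@induced_arrowE a' b') induced_hom_at_ob phiM invgK arrow_comp.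
rewrite scaler_sumr (bigD1 a') //= [X in _ = _ + X]big1 ?addr0; last first.
  move=> c nc; apply: arrow_noncomp; apply: contraNneq nc => ac.
  exact/eqP/val_inj.
by rewrite arrow_comp /transport gcompKV.
Qed.

End HomFromInduced.
End OneRepresentation.

(** The idempotent of [x] acts as zero on a module induced from another
    component, and not on one induced from [x]. *)
Lemma isomorphic_induced_linked (x y : gob X) d e
    (rG : mx_representation F [set: vertex_group x] d)
    (rH : mx_representation F [set: vertex_group y] e) :
  (0 < d)%N -> isomorphic_modules (induced rG) (induced rH) -> linked x y.
Proof.
move=> d_gt0 [f [g fK _]]; rewrite linked_sym; apply: contraT => nyx.
pose x0 : star x := Sub x (linked_refl x).
pose w := at_ob rG x0 (const_mx 1).
have w0 : w = 'E (gid x) *: w.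
  rewrite (@induced_arrowE _ _ _ x0 x0) at_ob_id.
  by rewrite (transport1 x0) invg1 repr_mx1 mulmx1.
have : w = 0.
  apply: (can_inj fK); rewrite w0 linearZ linear0 /=.
  exact: (@induced_arrow0 F X y e rH).
move=> /ffunP/(_ x0); rewrite at_ob_id ffunE => /rowP/(_ (Ordinal d_gt0)).
by rewrite !mxE => /eqP; rewrite oner_eq0.
Qed.

(** The representation is recovered from the induced module as its component
    at [x], where an isomorphism of modules restricts to an injective
    intertwiner. *)
Lemma induced_intertwiner (x : gob X) d e
    (rG : mx_representation F [set: vertex_group x] d)
    (rH : mx_representation F [set: vertex_group x] e) :
  isomorphic_modules (induced rG) (induced rH) ->
  exists2 A : 'M[F]_(d, e), row_free A & forall g, rG g *m A = A *m rH g.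
Proof.
move=> [f [g fK _]]; pose x0 : star x := Sub x (linked_refl x).
pose phi v := f (at_ob rG x0 v) x0.
have phi_at v : f (at_ob rG x0 v) = at_ob rH x0 (phi v).
  have e1 d' (r : mx_representation F [set: vertex_group x] d')
      (w : induced r) : 'E (gid x) *: w = at_ob r x0 (w x0).
    rewrite (@induced_arrowE _ _ _ x0 x0) (transport1 x0) invg1.
    by rewrite repr_mx1 mulmx1.
  by rewrite -e1 -linearZ /= e1 at_ob_id.
have phi_lin : linear phi.
  move=> k u v; rewrite /phi at_obD -at_ob_fscale linearD linearZ /= ffunE.
  by rewrite -/(fscale k _) induced_fscaleE ffunE.
pose p := GRing.isLinear.Build _ _ _ _ phi phi_lin.
pose phiL : {linear 'rV[F]_d -> 'rV[F]_e} := HB.pack phi p.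
have AE v : v *m lin1_mx phiL = phi v by rewrite mul_rV_lin1.
exists (lin1_mx phiL) => [|h].
  apply: inj_row_free => v; rewrite AE => phiv.
  have := phi_at v; rewrite phiv at_ob0 -(linear0 f) => /(can_inj fK).
  by move=> /ffunP/(_ x0); rewrite at_ob_id ffunE.
apply/row_matrixP => i; rewrite !rowE !mulmxA !AE.
set v := delta_mx 0 i; pose k := untransport x0 x0 (h^-1)%g.
have kE d' (r : mx_representation F [set: vertex_group x] d') u :
    'E k *: at_ob r x0 u = at_ob r x0 (u *m r h).
  by rewrite (@induced_arrowE _ _ _ x0 x0) untransportK invgK at_ob_id.
by rewrite /phi -kE linearZ /= phi_at kE !at_ob_id.
Qed.

End InducedTheory.

(** * Every simple module is induced from an irreducible representation *)

Section Classification.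
Variables (F : fieldType) (X : groupoid).
Notation B := (groupoid_algebra F X).
Notation "''E' f" := (gbasis F (arr f) : B) (at level 8, f at level 2).

(** Some component of a nonzero vector is nonzero, and arrows, being
    invertible, carry it to the base point without killing it. *)
Lemma simple_based_vector (V : lmodType B) : simple_module V ->
  exists x (v : V), [/\ base_point x = x, v != 0 & 'E (gid x) *: v = v].
Proof.
move=> [[v v0] _].
have [a va0] : exists a, 'E (gid a) *: v != 0.
  apply: contrapT => nv; case/eqP: v0; rewrite [v]arrow_id_sum big1 // => a _.
  by apply/eqP; apply: contrapT => /negP va; apply: nv; exists a.
have /linkedP[f _] := base_pointP a.
exists (base_point a), ('E f *: v); split; first exact: base_point_id.
  apply: contraNneq va0 => fv0.
  by rewrite -(gcompVm f) -arrow_comp fv0 scaler0.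
by rewrite arrow_comp gcomp1m.
Qed.

(** The map from the regular representation determined by [v], which sends the
    basis vector of [g] to the image of [v] under the inverse of [g]; the
    inverse turns right translation into the left action on [V]. *)
Section Orbit.
Variables (V : lmodType B) (x : gob X) (v : V).
Local Notation G := [set: vertex_group x]%G.
Local Notation aG := (regular_repr F G).

Definition orbit_map (u : 'rV[F]_(gcard G)) : V :=
  \sum_i fscale (u 0 i) ('E ((enum_val i)^-1%g : ghom x x) *: v).

Lemma orbit_mapD : {morph orbit_map : u w / u + w}.
Proof.
move=> u w; rewrite /orbit_map -big_split; apply: eq_bigr => i _.
by rewrite mxE fscaleDl.
Qed.

Lemma orbit_mapZ k u : orbit_map (k *: u) = fscale k (orbit_map u).
Proof.
by rewrite /orbit_map fscale_sumr; apply: eq_bigr => i _; rewrite mxE fscaleA.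
Qed.

Lemma orbit_map0 : orbit_map 0 = 0.
Proof. by rewrite -[0 in LHS](scale0r 0) orbit_mapZ fscale0l. Qed.

Lemma orbit_map_sum I (r : seq I) P (E : I -> 'rV[F]_(gcard G)) :
  orbit_map (\sum_(i <- r | P i) E i) = \sum_(i <- r | P i) orbit_map (E i).
Proof. exact: (big_morph _ orbit_mapD orbit_map0). Qed.

Lemma orbit_map_delta i :
  orbit_map (delta_mx 0 i) = 'E ((enum_val i)^-1%g : ghom x x) *: v.
Proof.
rewrite /orbit_map (bigD1 i) //= mxE !eqxx fscale1 big1 ?addr0 //.
move=> j /negPf ji.
by rewrite mxE ji andbF fscale0l.
Qed.

Lemma orbit_mapM (g : vertex_group x) u :
  orbit_map (u *m aG g) = 'E ((g^-1)%g : ghom x x) *: orbit_map u.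
Proof.
rewrite mulmx_sum_row orbit_map_sum scaler_sumr; apply: eq_bigr => i _.
rewrite orbit_mapZ fscaleC rowK orbit_map_delta gring_indexK ?inE //.
by rewrite arrow_comp invMg.
Qed.

End Orbit.

Hypothesis F'X : forall x : gob X, ([pchar F]^'.-group [set: vertex_group x])%g.

(** By Maschke's theorem the regular representation is a sum of simple
    submodules, and they cannot all be killed, since [v] is a value of
    [orbit_map v]. *)
Lemma simple_in_regular (V : lmodType B) x (v : V) :
  v != 0 -> 'E (gid x) *: v = v ->
  exists2 U, mxsimple (regular_repr F [set: vertex_group x]%G) U &
    exists u, orbit_map v (u *m U) != 0.
Proof.
move=> v0 xv; apply: contrapT => nU.
pose aG := regular_repr F [set: vertex_group x]%G.
have cr : mx_completely_reducible aG 1%:M := mx_Maschke_pchar aG (F'X x).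
(* a decomposition into simples is only available for proving a boolean *)
suff: false by [].
apply: (mx_reducible_semisimple (mxmodule1 aG) cr) => -[I W S simW W1 _].
exfalso.
have killW i u : orbit_map v (u *m W i) = 0.
  apply: contrapT => /eqP Wu; apply: nU; exists (W i); first exact: simW.
  by exists u.
have kill (u : 'rV_(gcard [set: vertex_group x])) : orbit_map v u = 0.
  have : (u <= \sum_i W i)%MS by rewrite -/S W1 submx1.
  case/sub_sumsmxP => c ->; rewrite orbit_map_sum big1 //.
pose i1 := gring_index [set: vertex_group x] 1%g.
case/eqP: v0; rewrite -(kill (delta_mx 0 i1)) orbit_map_delta.
by rewrite gring_indexK ?inE // invg1.
Qed.

Variable sG : forall x : gob X, irrType F [set: vertex_group x].

(** The simple submodule of the regular representation found in
    [simple_in_regular] is isomorphic to one of the listed irreducible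
    representations; by Frobenius reciprocity its map to [V] extends to the
    induced module, and Schur's lemma makes the extension bijective. *)
Lemma simple_is_induced (V : lmodType B) : simple_module V ->
  exists x : gob X, base_point x = x /\
    exists i : sG x, isomorphic_modules (induced (irr_repr i)) V.
Proof.
move=> simV; have [x [v [bx v0 xv]]] := simple_based_vector simV.
exists x; split=> //.
have [U simU [u Uu0]] := simple_in_regular v0 xv.
have modU : mxmodule (regular_repr F [set: vertex_group x]%G) U by case: simU.
have irrU := (submod_mx_irr modU).2 simU.
have rsim := rsim_irr_comp_pchar (sG x) (F'X x) irrU.
have [A eqd freeA homA] := mx_rsim_sym rsim.
exists (irr_comp (sG x) (submod_repr modU)).
set i := irr_comp _ _ in A eqd freeA homA rsim *.
pose phi (w : 'rV[F]_(irr_degree i)) := orbit_map v (val_submod (w *m A)).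
have phiD : {morph phi : w w' / w + w'}.
  by move=> w w'; rewrite /phi mulmxDl linearD orbit_mapD.
have phiZ k w : phi (k *: w) = fscale k (phi w).
  by rewrite /phi -scalemxAl linearZ orbit_mapZ.
have phiM (g : vertex_group x) w :
    phi (w *m irr_repr i g) = 'E ((g^-1)%g : ghom x x) *: phi w.
  rewrite /phi -mulmxA homA ?inE // mulmxA (val_submodJ modU) ?inE //.
  exact: orbit_mapM.
pose Phi := induced_hom (rG := irr_repr i) phi.
have Phi_lin : linear Phi := induced_hom_linear phiD phiZ phiM.
have fullA : row_full A by rewrite /row_full -[X in _ == X]eqd.
have [w phiw] : exists w, phi w != 0.
  exists (in_submod U (u *m U) *m pinvmx A).
  by rewrite /phi mulmxKpV ?submx_full // in_submodK ?submxMl.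
apply: (linear_isomorphic Phi_lin).
pose p := GRing.isLinear.Build _ _ _ _ Phi Phi_lin.
pose PhiL : {linear induced (irr_repr i) -> V} := HB.pack Phi p.
pose x0 : star x := Sub x (linked_refl x).
apply: (@simple_hom_bij _ _ _ PhiL (at_ob (irr_repr i) x0 w)) => //.
  exact/induced_simple/socle_irr.
rewrite [PhiL _]induced_hom_at_ob //.
apply: contraNneq phiw => ew.
by rewrite -(hom_vertex_id phiM) -(gcompVm (spoke x0)) -arrow_comp ew scaler0.
Qed.

End Classification.

(** * The number of simple modules *)

Section Counting.
Variables (F : closedFieldType) (X : groupoid).
Notation B := (groupoid_algebra F X).
Hypothesis F'X : forall x : gob X, ([pchar F]^'.-group [set: vertex_group x])%g.

Let sG (x : gob X) : irrType F [set: vertex_group x] := DecSocleType _.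

(** Simple modules are indexed by a component, given by its base point, and an
    irreducible representation of the vertex group there. *)
Let based := {x : gob X | base_point x == x}.
Let index := {x : based & sG (val x)}.

Let ind (k : index) : lmodType B := induced (irr_repr (tagged k)).

(** The intertwiners in both directions are injective, so that the degrees
    agree and the representations are similar. *)
Let ind_inj (k l : index) : isomorphic_modules (ind k) (ind l) -> k = l.
Proof.
case: k l => [x i] [y j] iso.
have exy : x = y.
  apply/val_inj; rewrite /= -(eqP (valP x)) -(eqP (valP y)).
  apply/base_point_linked/(isomorphic_induced_linked _ iso).
  exact: irr_degree_gt0.
subst y; congr Tagged; rewrite -(irr_reprK_pchar (F'X _) i).
rewrite -(irr_reprK_pchar (F'X _) j); apply: irr_comp_rsim_pchar => //.
have [A freeA homA] := induced_intertwiner iso.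
have [C freeC _] := induced_intertwiner (isomorphic_sym iso).
apply: (@MxReprSim _ _ _ _ _ _ _ A) => //.
apply/eqP; rewrite eqn_leq; apply/andP; split.
  by rewrite -(eqP freeA) rank_leq_col.
by rewrite -(eqP freeC) rank_leq_col.
Qed.

(** Over a closed field whose characteristic divides no order of a vertex
    group, a vertex group has as many irreducible representations as conjugacy
    classes. *)
Lemma card_Irr_groupoid_algebra : has_card (Irr B)
  (\sum_(x : gob X | base_point x == x) #|classes [set: vertex_group x]|)%N.
Proof.
pose N := #|{: index}|.
have <- : N = (\sum_(x : gob X | base_point x == x)
                #|classes [set: vertex_group x]|)%N.
  rewrite /N card_tagged sumnE big_map big_enum /=.
  rewrite [RHS](big_sub (fun x : gob X => base_point x == x)).
  apply: eq_bigr => x _; apply: card_irr_pchar; first exact: F'X.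
  exact: group_closure_closed_field.
have classP (k : index) : is_simple_iso_class (isomorphic_modules (ind k)).
  by exists (ind k) => //; apply/induced_simple/socle_irr.
pose cl (k : index) : Irr B := exist _ _ (classP k).
have cl_inj : injective cl.
  move=> k l /(congr1 sval) /= ekl; apply: ind_inj.
  by rewrite ekl; apply: isomorphic_refl.
have cl_surj (C : Irr B) : exists k, cl k = C.
  case: C => C simC; have [V simV eC] := simC.
  have [x [bx [i iso]]] := simple_is_induced F'X sG simV.
  pose bx' : based := exist _ x (introT eqP bx).
  exists (Tagged (fun x : based => sG (val x)) (i : sG (val bx'))).
  apply: eq_sig_hprop => [? ? ?|] /=; first exact: Prop_irrelevance.
  by rewrite eC; apply: isomorphic_class.
have cl_bij : bijective cl.
  exists (fun C => projT1 (cid (cl_surj C))) => [k|C]; last by case: cid.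
  by apply: cl_inj; case: cid.
exists (cl \o enum_val); apply: bij_comp => //; exact: enum_val_bij.
Qed.

End Counting.

(** * Counting commuting tuples *)

(** Orbit counting for the conjugation action of [H] on itself. *)
Lemma card_classes_centralisers (gT : finGroupType) (H : {group gT}) :
  (\sum_(h in H) #|'C_H[h]|)%g = (#|classes H| * #|H|)%N.
Proof.
have actH : [acts H, on H | 'J] by rewrite astabsJ normG.
rewrite -[classes H]/(orbit 'J H @: H)%g -(Frobenius_Cauchy actH).
by apply: eq_bigr => h _; rewrite afixJ cent_set1.
Qed.

Section VertexIso.
Variable X : groupoid.

(** Conjugation by an arrow from [a] to [b]. *)
Lemma vertex_isog (a b : gob X) : linked a b ->
  ([set: vertex_group a] \isog [set: vertex_group b])%g.
Proof.
move=> /linkedP[t _].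
pose f (h : vertex_group a) : vertex_group b := gcomp t (gcomp h (ginv t)).
pose f' (h : vertex_group b) : vertex_group a := gcomp (ginv t) (gcomp h t).
have fK : cancel f f'.
  by move=> h; rewrite /f /f' -!gcompA gcompVm gcompm1 gcompVK.
have f'K : cancel f' f.
  by move=> h; rewrite /f /f' -!gcompA gcompmV gcompm1 gcompKV.
have fM : {in [set: vertex_group a] &, {morph f : h k / (h * k)%g}}.
  by move=> h k _ _; rewrite !vertex_mulE /f -!gcompA gcompVK.
apply/isogP; exists (Morphism fM).
  by apply/injmP => h k _ _ /(can_inj fK).
rewrite morphimEdom; apply/setP => h; rewrite inE; apply/imsetP.
by exists (f' h); rewrite ?inE //= f'K.
Qed.

(** A sum over components becomes a sum over objects: [n] arrows leave [a], and
    each object of its component receives as many of them as its vertex group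
    has elements. *)
Lemma sum_based_classes n : (forall a : gob X, \sum_b #|ghom a b| = n)%N ->
  ((\sum_(a : gob X | base_point a == a) #|classes [set: vertex_group a]|) * n =
   \sum_(a : gob X)
     #|classes [set: vertex_group a]| * #|[set: vertex_group a]|)%N.
Proof.
move=> Xn; rewrite big_distrl /=.
rewrite [RHS](partition_big (@base_point X)
  (fun a => base_point a == a)) /=; last first.
  by move=> a _; rewrite base_point_id.
apply: eq_bigr => a /eqP ba; rewrite -(Xn a) big_distrr /=.
rewrite (bigID (linked a)) /= addnC big1 ?add0n => [|b nab]; last first.
  by move: nab; rewrite /linked -eqn0Ngt => /eqP->; rewrite muln0.
apply: eq_big => [b|b ab].
  apply/idP/eqP => [/base_point_linked <- //|<-].
  by rewrite linked_sym base_pointP.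
rewrite (nclasses_isog (vertex_isog ab)) (card_hom_linked ab).
congr (_ * _)%N; rewrite -(card_isog (vertex_isog ab)) cardsT.
by apply: (@bij_eq_card (ghom a a) (vertex_group a) id); exists id.
Qed.

End VertexIso.

Section CommutingTuples.
Variables (gT : finGroupType) (G : {group gT}).
Local Open Scope group_scope.

Lemma Comm_cons r z (t : r.-tuple gT) :
  ([tuple of z :: t] \in Comm G r.+1) =
  [&& z \in G, all (fun y => z * y == y * z) t & t \in Comm G r].
Proof.
rewrite !inE; apply/andP/and3P.
  move=> [/forallP tG /'forall_forallP tC]; split.
  - by have := tG ord0.
  - apply/all_tnthP => i; have := tC ord0 (lift ord0 i).
    by rewrite tnth0 tnthS.
  apply/andP; split.
    by apply/forallP => i; have := tG (lift ord0 i); rewrite tnthS.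
  apply/'forall_forallP => i j; have := tC (lift ord0 i) (lift ord0 j).
  by rewrite !tnthS.
move=> [zG /all_tnthP zt /andP[/forallP tG /'forall_forallP tC]]; split.
  apply/forallP => i.
  by case: (unliftP ord0 i) => [j|] ->; rewrite ?tnthS ?tnth0.
apply/'forall_forallP => i j.
case: (unliftP ord0 i) => [i'|] ->; case: (unliftP ord0 j) => [j'|] ->;
  rewrite ?tnthS ?tnth0 //.
by rewrite eq_sym.
Qed.

Lemma Comm0 (t : 0.-tuple gT) : t \in Comm G 0.
Proof. by rewrite inE; apply/andP; split; apply/forallP => -[]. Qed.

(** Orbit counting again: a commuting [r]-tuple fixed by [z] under conjugation
    is the tail of a commuting tuple with head [z]. *)
Lemma card_kappa r : (kappa G r * #|G| = #|Comm G r.+1|)%N.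
Proof.
have actG : [acts G, on Comm G r | 'J * r].
  apply/actsP => x xG t; rewrite !inE; congr (_ && _).
    by apply: eq_forallb => i; rewrite tnth_map /= groupJr.
  apply: eq_forallb => i; apply: eq_forallb => j; rewrite !tnth_map /=.
  by rewrite -!conjMg (inj_eq (@conjg_inj _ x)).
rewrite /kappa -(Frobenius_Cauchy actG) -[RHS]sum1_card.
rewrite (partition_big (@thead _ _) (fun z => z \in G)) /=; last first.
  by move=> t; case/tupleP: t => z t; rewrite Comm_cons theadE => /andP[].
apply: eq_bigr => z zG; rewrite sum1_card.
have cons_inj : injective (fun t : r.-tuple gT => [tuple of z :: t]).
  by move=> t u /(congr1 val) [] /val_inj.
rewrite -(card_imset _ cons_inj).
apply: eq_card => t; case/tupleP: t => y t.
apply/esym; transitivity (([tuple of y :: t] \in Comm G r.+1) &&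
              (thead [tuple of y :: t] == z)); first by [].
rewrite Comm_cons theadE; apply/andP/imsetP; last first => [[u]|].
  rewrite inE => /andP[uC /afix1P uz] /(congr1 val) /= [-> tu].
  have -> : t = u by apply: val_inj.
  split=> //; rewrite zG uC andbT; apply/all_tnthP => i.
  have := congr1 (fun v => tnth v i) uz; rewrite tnth_map /= => /conjg_fixP.
  by move=> /commgP c; apply/eqP/esym.
move=> [] /[swap] /eqP -> /and3P[_ /all_tnthP zt tC]; exists t => //.
rewrite inE tC; apply/afix1P; apply: eq_from_tnth => i; rewrite tnth_map /=.
by apply/conjg_fixP/commgP/esym/eqP; apply: zt.
Qed.

Local Notation X := (double_loop_groupoid G).

(** Each element of [G] is an arrow from [a] to exactly one object. *)
Lemma sum_card_hom (a : gob X) : (\sum_b #|ghom a b| = #|G|)%N.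
Proof.
rewrite (eq_bigr (fun b : loop2_ob G => \sum_(x | loop2_pred a b x) 1)%N).
  rewrite (exchange_big_dep (fun x => x \in G)) /=; last first.
    by move=> b x _ /and3P[].
  rewrite -[RHS]sum1_card; apply: eq_bigr => x xG.
  case: a => -[g h] gh; have /and3P[/= gG hG /eqP gh1] := gh.
  have bP : [&& x * g * x^-1 \in G, x * h * x^-1 \in G
      & (x * g * x^-1) * (x * h * x^-1) == (x * h * x^-1) * (x * g * x^-1)].
    by rewrite !groupM ?groupV //= !mulgA !mulgKV -![x * _ * _]mulgA gh1.
  pose b : loop2_ob G := Sub (x * g * x^-1, x * h * x^-1) bP.
  rewrite (big_pred1 b) // => -[[c1 c2] cP]; rewrite /loop2_pred xG /=.
  by rewrite -val_eqE /= xpair_eqE [c1 == _]eq_sym [c2 == _]eq_sym.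
by move=> b _; rewrite sum1_card card_sig; apply: eq_card.
Qed.

Lemma conj_eq_commute (y g : gT) : (y * g * y^-1 == g) = (g * y == y * g).
Proof. by rewrite -(inj_eq (mulIg y)) mulgKV eq_sym. Qed.

Definition arrow_elt (a : gob X) (f : vertex_group a) : gT :=
  sval (f : loop2_hom a a).

(** The summand at [a] counts the pairs of commuting elements of the vertex
    group at [a]; together with the pair [a] they form the commuting
    quadruples. *)
Lemma sum_classes_Comm :
  (\sum_(a : gob X)
     #|classes [set: vertex_group a]| * #|[set: vertex_group a]| =
   #|Comm G 4|)%N.
Proof.
pose T : finType := {a : gob X & (vertex_group a * vertex_group a)%type}.
pose Phi (p : T) : 4.-tuple gT := [tuple (val (tag p : loop2_ob G)).1;
  (val (tag p : loop2_ob G)).2; arrow_elt (tagged p).1; arrow_elt (tagged p).2].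
have Phi_inj : injective Phi.
  move=> [[[g h] gh] [[y yP] [z zP]]] [[[g' h'] gh'] [[y' yP'] [z' zP']]].
  move=> /(congr1 val) /= []; rewrite /arrow_elt /= => eg eh ey ez; subst.
  rewrite (bool_irrelevance gh' gh) in yP' zP' *.
  by rewrite (bool_irrelevance yP' yP) (bool_irrelevance zP' zP).
transitivity
    #|[set p : T | (tagged p).1 * (tagged p).2 == (tagged p).2 * (tagged p).1]|.
  rewrite -sum1_card (eq_bigl (fun p : T => xpredT (tag p) &&
    ((tagged p).1 * (tagged p).2 == (tagged p).2 * (tagged p).1)));
    last by move=> p; rewrite inE.
  rewrite -(@sig_big_dep _ _ addn _ _ xpredT
    (fun a (p : vertex_group a * vertex_group a) => p.1 * p.2 == p.2 * p.1)
    (fun _ _ => 1%N)) /=.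
  apply: eq_bigr => a _.
  rewrite -(card_classes_centralisers [set: vertex_group (X := X) a]%G).
  rewrite -(pair_big_dep xpredT
    (fun h k : vertex_group (X := X) a => h * k == k * h) (fun _ _ => 1%N)) /=.
  apply: eq_big => [h|h _]; first by rewrite inE.
  rewrite sum1_card; apply: eq_card => k.
  transitivity (h * k == k * h); last by [].
  by rewrite finset.in_setI finset.in_setT; apply/cent1P/eqP => /esym.
rewrite -(card_imset _ Phi_inj); apply: eq_card => t.
case/tupleP: t => g t; case/tupleP: t => h t; case/tupleP: t => y t.
case/tupleP: t => z t; rewrite (tuple0 t) {t} !Comm_cons Comm0 /= !andbT.
apply/imsetP/idP => [[p]|].
  case: p => [[[g' h'] gh'] [[y' yP] [z' zP]]].
  rewrite inE => /eqP/(congr1 val) /= yz.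
  move=> /(congr1 val) /= []; rewrite /arrow_elt /= => -> -> -> ->.
  have /and3P[/= -> -> ->] := gh'.
  move: yP zP; rewrite /loop2_pred /= !conj_eq_commute.
  by move=> /and3P[-> -> ->] /and3P[-> -> ->]; rewrite yz eqxx.
case/andP=> gG /andP[/and3P[gh gy gz] /andP[hG /andP[/andP[hy hz]]]].
case/and3P=> yG yz zG.
have aP : [&& g \in G, h \in G & g * h == h * g] by rewrite gG hG.
pose a : loop2_ob G := Sub (g, h) aP.
have yP : loop2_pred a a y by rewrite /loop2_pred yG /= !conj_eq_commute gy.
have zP : loop2_pred a a z by rewrite /loop2_pred zG /= !conj_eq_commute gz.
pose y1 : loop2_hom a a := Sub y yP; pose z1 : loop2_hom a a := Sub z zP.
exists (Tagged (fun a : gob X => (vertex_group a * vertex_group a)%type)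
  (y1 : vertex_group (a : gob X), z1 : vertex_group (a : gob X))).
  by rewrite inE /=; apply/eqP/val_inj/eqP.
exact: val_inj.
Qed.

(** Multiplied by the order of [G], both sides count commuting quadruples. *)
Lemma sum_classes_kappa :
  (\sum_(a : gob X | base_point a == a) #|classes [set: vertex_group a]|
   = kappa G 3)%N.
Proof.
apply/eqP; rewrite -(eqn_pmul2r (cardG_gt0 G)) card_kappa.
by rewrite (sum_based_classes sum_card_hom) sum_classes_Comm.
Qed.

End CommutingTuples.

Lemma pchar0_group (F : numDomainType) (gT : finGroupType) (G : {group gT}) :
  ([pchar F]^'.-group G)%g.
Proof. by apply/pgroupP => p _ _; rewrite inE /= Num.Theory.pchar_num. Qed.

Theorem corollary4p9 (R : realType) (gT : finGroupType) (G : {group gT}) :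
  let B := groupoid_algebra R[i] (double_loop_groupoid G) in
  exists N : nat,
    [/\ has_card (Irr B) N,
        N = kappa G 3,
        (kappa G 3)%:R = #|G|%:R ^+ 3 * Pcomm G 4 :> rat
      & Pcomm G 4 = N%:R / #|G|%:R ^+ 3 :> rat].
Proof.
move=> B; exists (kappa G 3).
have G0 : #|G|%:R != 0 :> rat by rewrite Num.Theory.pnatr_eq0 -lt0n cardG_gt0.
have P4 : Pcomm G 4 = (kappa G 3)%:R / #|G|%:R ^+ 3.
  by rewrite /Pcomm -card_kappa natrM exprS invfM mulrA mulfK.
split=> //.
- rewrite -sum_classes_kappa; apply: card_Irr_groupoid_algebra => a.
  exact: pchar0_group.
- by rewrite P4 mulrC divfK ?expf_neq0.
Qed.
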